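(* Let $S\mathbb S^{2n+1}$ be the unit sphere bundle of $T\mathbb S^{2n+1}$, and let $\widetilde{\mathcal M}_*:=\psi^{-1}(0)\subset S\mathbb S^{2n+1}$, where $\psi$ is the contact angle. There is a smooth map \[ (0,\infty)\times S\mathbb S^{2n+1}\setminus\big(\{2\}\times\widetilde{\mathcal M}_*\big)\to\mathbb C^{n+1}\times\mathbb C^{n+1},\qquad (s,z,v)\mapsto(w_0,w_1), \] where, for a given $s$, $(w_0,w_1)$ can be determined as a function of $(z,v)$, with $\psi=\psi(z,v)$, by \[ w_0=\frac{1}{2\mathrm i|C_s(\psi)|}\Big(\mathrm i\big(|C_s(\psi)|+\tfrac s2\big)z-v\Big),\qquad w_1=\frac{1}{2\mathrm i|C_s(\psi)|}\Big(\mathrm i\big(|C_s(\psi)|-\tfrac s2\big)z+v\Big), \] and, vice versa, $(z,v)$ can be explicitly computed as a function of $(w_0,w_1)$ by \[ z=w_0+w_1,\qquad v=\mathrm i\tfrac s2(w_0+w_1)+\mathrm i|C_s(\psi)|(w_1-w_0). \] Moreover, the magnetic geodesic $\gamma$ with strength $s$, initial condition $(z,v)\in S\mathbb S^{2n+1}$ and contact angle $\psi$ is contained in the Clifford torus $\mathbb T^2_{w_0,w_1}$ with width \[ \tau=\mathrm{Arg}(C_s(\psi)).\qquad (\ast) \] More precisely, $\gamma$ has the form \[ \gamma(t)=e^{\mathrm i\frac s2t}\Big(e^{-\mathrm i|C_s(\psi)|t}w_0+e^{\mathrm i|C_s(\psi)|t}w_1\Big),\quad\forall\,t\in\mathbb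 R.\qquad (\ast\ast) \] In particular, for $\psi\in(0,\pi)$, $\gamma$ has rotation number \[ \rho_s(\psi):=\frac{\frac s2-|C_s(\psi)|}{\frac s2+|C_s(\psi)|}. \] The function $\rho_s:(0,\pi)\to(\rho_s^-,\rho_s^+)$ is bijective and monotonically decreasing, where \[ \rho_s^-:=-\tfrac1{1+s},\ \forall\,s\ge0,\qquad \rho_s^+:=\begin{cases}s-1,&\forall\, s\le2,\\ \frac1{s-1},&\forall\, s\ge2.\end{cases} \] Vice versa, if $\gamma$ satisfies $(\ast\ast)$ for an admissible pair $(w_0,w_1)$ with width $\tau$ given by $(\ast)$, then $\gamma$ is a unit speed magnetic geodesic with strength $s$ and contact angle $\psi$.
   Context: $\mathbb S^{2n+1}$ is the unit sphere in $\mathbb C^{n+1}$ with standard Hermitian product $\langle\cdot,\cdot\rangle$; $g=\mathrm{Re}\langle\cdot,\cdot\rangle$; $\alpha_z=\tfrac12\mathrm{Re}\langle\mathrm iz,\cdot\rangle$. For a closed two-form $\sigma$ the Lorentz force $Y$ is given by $g(Yu,v)=\sigma(u,v)$, and magnetic geodesics of $(\mathbb S^{2n+1},g,\sigma)$ are curves with $\nabla_{\dot\gamma}\dot\gamma=Y_\gamma\dot\gamma$ ($\nabla$ the Levi-Civita connection). A magnetic geodesic of strength $s$ is a unit speed magnetic geodesic $\gamma:\mathbb R\to\mathbb S^{2n+1}$ of $(\mathbb S^{2n+1},g,s\,\mathrm d\alpha)$; initial condition $(z,v)$ means $\gamma(0)=z$, $\dot\gamma(0)=v$. The contact angle $\psi(z,v)\in[0,\pi]$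 of $(z,v)\in S\mathbb S^{2n+1}$ is given by $\cos\psi(z,v)=g_z(\mathrm iz,v)$; it is constant along unit speed magnetic geodesics of strength $s$ and is called their contact angle. A pair $w_0,w_1\in\mathbb C^{n+1}$ is admissible if $\langle w_0,w_1\rangle=0$ and $|w_0|^2+|w_1|^2=1$. Its width is the unique number $\tau\in[0,\pi]$ with $|w_0|=\cos(\tfrac\tau2)$, $|w_1|=\sin(\tfrac\tau2)$, or, equivalently, $|w_0|^2-|w_1|^2=\cos\tau$. The Clifford torus associated with an admissible pair is $\mathbb T^2_{w_0,w_1}:=\{\lambda_0w_0+\lambda_1w_1\mid\lambda_0,\lambda_1\in\mathbb C,\ |\lambda_0|=|\lambda_1|=1\}$; its width is the width of the associated pair $(w_0,w_1)$ (since $\mathbb T^2_{w_0,w_1}=\mathbb T^2_{w_1,w_0}$, the width of the torus is defined only up to the identification $\tau\sim\pi-\tau$). For $s\ge0$ and $\psi\in[0,\pi]$, $C_s(\psi):=(-\tfrac s2+\cos\psi,\sin\psi)\in\mathbb R^2$; $|C_s(\psi)|$ is its Euclidean norm and $\mathrm{Arg}(C_s(\psi))\in[0,\pi]$ its angle from the positive $x$-axis as seen from the origin, with the convention $\mathrm{Arg}(C_2(0))=\tfrac\pi2$. The rotation number of a curve $t\mapsto e^{\mathrm i\theta_0t}w_0+e^{\mathrm i\theta_1t}w_1$ on $\mathbb T^2_{w_0,w_1}$ is the ratio $\theta_0/\theta_1$ of the frequencies of rotation in the $w_0$- and $w_1$-factors.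
   Formalization: In the converse the width τ is that of (w_1,w_0), i.e. |w_1|=cos(τ/2), |w_0|=sin(τ/2): with (w_0,w_1) it fails (s=1, ψ=0 gives a constant curve). Bijectivity and monotonicity of ρ_s are stated for s>0, since ρ_0 is constant with empty target interval. *)

(* Defs.v *)
From HB Require Import structures.
From mathcomp Require Export all_boot all_order all_algebra.
From mathcomp Require Export complex.
From mathcomp Require Export all_classical all_reals all_analysis.
Export Order.TTheory GRing.Theory Num.Theory.
Export numFieldNormedType.Exports.

Set Implicit Arguments.
Unset Strict Implicit.
Unset Printing Implicit Defensive.

Local Open Scope classical_set_scope.
Local Open Scope ring_scope.
Local Open Scope complex_scope.

(* C^(n+1), with (x, y) standing for x + i y.  Splitting into real and imaginary
   parts makes it a normed module over R, so that derive and derive1 apply; the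
   (sup) norm it carries is only used through its topology. *)
Notation cvec R n := ('rV[R]_(n.+1) * 'rV[R]_(n.+1))%type.

(* Explicitly 0 + 1 i: the generic 'i of numClosedFieldType is only known to be
   some square root of -1. *)
Definition iC (R : realType) : R[i] := 0 +i* 1.

Definition coord (R : realType) (n : nat) (z : cvec R n) (j : 'I_n.+1) : R[i] :=
  z.1 ord0 j +i* z.2 ord0 j.

Definition cscale (R : realType) (n : nat) (a : R[i]) (z : cvec R n) : cvec R n :=
  (complex.Re a *: z.1 - complex.Im a *: z.2,
   complex.Re a *: z.2 + complex.Im a *: z.1).

Notation "a *c: z" := (cscale a z) (at level 40) : complex_scope.

Definition herm (R : realType) (n : nat) (z w : cvec R n) : R[i] :=
  \sum_(j < n.+1) coord z j * conjc (coord w j).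

Definition metric (R : realType) (n : nat) (u v : cvec R n) : R :=
  complex.Re (herm u v).

Definition enorm (R : realType) (n : nat) (u : cvec R n) : R :=
  Num.sqrt (metric u u).

Definition expi (R : realType) (x : R) : R[i] := cos x +i* sin x.

(* Smoothness on an open set U: partial derivatives of all orders, in all
   directions, exist and are continuous on U. *)
Fixpoint Ck (R : realType) (V W : normedModType R) (k : nat) (U : set V)
    (f : V -> W) : Prop :=
  (forall x, U x -> {for x, continuous f}) /\
  if k is k'.+1 then
    forall v : V, (forall x, U x -> derivable f x v) /\
                  Ck k' U (fun x => 'D_v f x)
  else True.

Definition smooth (R : realType) (V W : normedModType R) (U : set V)
    (f : V -> W) : Prop :=
  forall k, Ck k U f.

(* Smoothness on a subset D (e.g. a submanifold) of V: f is locally the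
   restriction to D of a smooth map on an open subset of V. *)
Definition smooth_on (R : realType) (V W : normedModType R) (D : set V)
    (f : V -> W) : Prop :=
  forall p, D p -> exists (U : set V) (F : V -> W),
    [/\ open U, U p, smooth U F & forall x, D x -> U x -> F x = f x].

Definition sphere (R : realType) (n : nat) : set (cvec R n) :=
  [set z | enorm z = 1].

Definition tangent (R : realType) (n : nat) (z : cvec R n) : set (cvec R n) :=
  [set u | metric z u = 0].

Definition unit_tangent (R : realType) (n : nat) (z v : cvec R n) : Prop :=
  [/\ sphere z, tangent z v & enorm v = 1].

Definition alpha (R : realType) (n : nat) (z v : cvec R n) : R :=
  2^-1 * metric (iC R *c: z) v.

(* Exterior derivative of a one-form on C^(n+1); v and u are extended to
   constant vector fields, hence there is no bracket term.  As d commutes with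
   pull-backs, evaluating it on tangent vectors of the sphere gives the exterior
   derivative of the restricted form. *)
Definition ext_deriv (R : realType) (n : nat) (a : cvec R n -> cvec R n -> R)
    (z u v : cvec R n) : R :=
  'D_u (fun x => a x v : R^o) z - 'D_v (fun x => a x u : R^o) z.

Definition lorentz_force (R : realType) (n : nat)
    (sigma : cvec R n -> cvec R n -> cvec R n -> R)
    (Y : cvec R n -> cvec R n -> cvec R n) : Prop :=
  forall z u, sphere z -> tangent z u ->
    tangent z (Y z u) /\
    forall v, tangent z v -> metric (Y z u) v = sigma z u v.

(* Covariant derivative of the vector field X along the curve gamma in the
   sphere: orthogonal projection of the Euclidean derivative to the tangent
   space at gamma t. *)
Definition cov_deriv (R : realType) (n : nat) (gamma X : R -> cvec R n) (t : R) :
    cvec R n :=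
  derive1 X t - metric (gamma t) (derive1 X t) *: gamma t.

Definition magnetic_geodesic (R : realType) (n : nat)
    (sigma : cvec R n -> cvec R n -> cvec R n -> R) (gamma : R -> cvec R n) :
    Prop :=
  [/\ smooth setT (gamma : R^o -> cvec R n),
      forall t, sphere (gamma t) &
      exists Y, lorentz_force sigma Y /\
        forall t, cov_deriv gamma (derive1 gamma) t = Y (gamma t) (derive1 gamma t)].

Definition magnetic_geodesic_of_strength (R : realType) (n : nat) (s : R)
    (gamma : R -> cvec R n) : Prop :=
  magnetic_geodesic (fun z u v => s * ext_deriv (@alpha R n) z u v) gamma /\
  forall t, enorm (derive1 gamma t) = 1.

Definition contact_angle (R : realType) (n : nat) (z v : cvec R n) : R :=
  acos (metric (iC R *c: z) v).

(* (0, oo) x S(S^(2n+1)) minus {2} x psi^-1(0), inside R x C^(n+1) x C^(n+1). *)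
Definition parameter_domain (R : realType) (n : nat) :
    set (R^o * cvec R n * cvec R n) :=
  [set p : R^o * cvec R n * cvec R n |
     [/\ 0 < p.1.1, unit_tangent p.1.2 p.2 &
         ~ (p.1.1 = 2 /\ contact_angle p.1.2 p.2 = 0)]].

Definition Cs (R : realType) (s psi : R) : R * R := (- (s / 2) + cos psi, sin psi).

Definition norm2 (R : realType) (p : R * R) : R := Num.sqrt (p.1 ^+ 2 + p.2 ^+ 2).

(* Angle in [0, pi] between p and the positive x-axis; only used for points of
   the closed upper half plane.  Cs s psi vanishes only for s = 2, psi = 0. *)
Definition Arg (R : realType) (p : R * R) : R :=
  if p == (0, 0) then pi / 2 else acos (p.1 / norm2 p).

Definition admissible (R : realType) (n : nat) (w0 w1 : cvec R n) : Prop :=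
  herm w0 w1 = 0 /\ enorm w0 ^+ 2 + enorm w1 ^+ 2 = 1.

Definition pair_width (R : realType) (n : nat) (w0 w1 : cvec R n) (tau : R) :
    Prop :=
  [/\ 0 <= tau <= pi, enorm w0 = cos (tau / 2) & enorm w1 = sin (tau / 2)].

Definition clifford_torus (R : realType) (n : nat) (w0 w1 : cvec R n) :
    set (cvec R n) :=
  [set z | exists l0 l1 : R[i],
     [/\ `|l0| = 1, `|l1| = 1 & z = l0 *c: w0 + l1 *c: w1]].

(* As clifford_torus w0 w1 = clifford_torus w1 w0, a torus of width tau also has
   width pi - tau. *)
Definition torus_width (R : realType) (n : nat) (T : set (cvec R n)) (tau : R) :
    Prop :=
  exists w0 w1 : cvec R n,
    [/\ admissible w0 w1, T = clifford_torus w0 w1 & pair_width w0 w1 tau].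

(* The conditions w0 != 0 and w1 != 0 make the frequencies, hence their ratio,
   unique. *)
Definition has_rotation_number (R : realType) (n : nat) (w0 w1 : cvec R n)
    (gamma : R -> cvec R n) (r : R) : Prop :=
  [/\ w0 != 0, w1 != 0 & exists th0 th1 : R,
    [/\ th1 != 0,
        forall t, gamma t = expi (th0 * t) *c: w0 + expi (th1 * t) *c: w1 &
        r = th0 / th1]].

Definition geodesic_form (R : realType) (n : nat) (s psi : R) (w0 w1 : cvec R n)
    (gamma : R -> cvec R n) : Prop :=
  forall t, gamma t =
    expi (s / 2 * t) *c: (expi (- (norm2 (Cs s psi) * t)) *c: w0 +
                          expi (norm2 (Cs s psi) * t) *c: w1).

Definition rho (R : realType) (s psi : R) : R :=
  (s / 2 - norm2 (Cs s psi)) / (s / 2 + norm2 (Cs s psi)).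

Definition rho_minus (R : realType) (s : R) : R := - (1 + s)^-1.

Definition rho_plus (R : realType) (s : R) : R :=
  if s <= 2 then s - 1 else (s - 1)^-1.

(* Main.v *)
From HB Require Import structures.
Require Import Defs.
From mathcomp Require Import ring lra.

(** On the sphere [d alpha (u, v) = Re <i u, v>], so the Lorentz force of
strength [s] is [s] times the tangential part of [i u].  Along a unit speed
magnetic geodesic the normal part of [gamma''] is [- gamma], and the cosine of
the contact angle, [k = Re <i gamma, gamma'>], has derivative
[Re <i gamma, gamma''> = s Re <gamma, gamma'> = 0].  The geodesic equation thereby
becomes a linear equation with constant coefficients
([magnetic_geodesic_ode]):
[[
  gamma'' = s i gamma' + (s k - 1) gamma.
]]
Its characteristic exponents are [i th0] and [i th1] with
[th0, th1 = s / 2 -+ c] and [c ^ 2 = s ^ 2 / 4 - s k + 1 = |C_s(psi)| ^ 2].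
Splitting the second order operator into two commuting first order factors
([second_order_ode]) shows that the solution is
[e^(i th0 t) w0 + e^(i th1 t) w1], with [w0] and [w1] the solution of
[z = w0 + w1], [v = i (th0 w0 + th1 w1)].

Unit speed and tangency of [v] make [w0] and [w1] Hermitian orthogonal, and
[c (|w1|^2 - |w0|^2) = k - s / 2] ([pair_admissible]); the right-hand side is
the first coordinate of [C_s(psi)], that is, [c] times the cosine of its angle,
which is the claim on the width.  The computation can be read backwards: these
two identities for an admissible pair give unit speed, contact angle [psi] and
the geodesic equation for the curve ([torus_curve_magnetic]), also in the
degenerate case [c = 0].

The pair depends on [(s, z, v)] through [1 / c] and operations that are linear
or bilinear; [c ^ 2] is a polynomial which is positive off the excluded set, so
smoothness reduces to that of [1 / sqrt q] for a smooth positive [q]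
([Ck_invsqrt]).  Finally the rotation number equals [s / (s / 2 + c) - 1], a
decreasing function of [c], and [c] increases with [psi] from [|1 - s / 2|] to
[1 + s / 2]. *)

Set Implicit Arguments.
Unset Strict Implicit.
Unset Printing Implicit Defensive.

Local Open Scope classical_set_scope.
Local Open Scope ring_scope.
Local Open Scope complex_scope.

(** * Directional derivatives of linear and bilinear expressions *)

Definition continuous_bilinear (R : realType) (W1 W2 W3 : normedModType R)
    (B : W1 -> W2 -> W3) : Prop :=
  [/\ forall w, linear (B w), forall w, linear (B ^~ w) &
      continuous (fun p : W1 * W2 => B p.1 p.2)].

Section DirectionalDerivatives.
Context (R : realType).
Implicit Types V W : normedModType R.

(** Makes the rules for bundled linear maps available for a bare linearity
hypothesis, such as that of one argument of a bilinear map. *)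
Lemma linearZB W1 W2 (L : W1 -> W2) : linear L ->
  (forall a u, L (a *: u) = a *: L u) /\ (forall u u', L (u - u') = L u - L u').
Proof.
move=> linL; pose HL := GRing.isLinear.Build R W1 W2 *:%R L linL.
pose L' : {linear W1 -> W2} := HB.pack L HL.
by split=> [a u|u u']; [exact: (linearZ_LR L')|exact: (linearB L')].
Qed.

(** A directional derivative says nothing about continuity at [x], but it forces
continuity along the line, which is what the product rule needs. *)
Lemma derivable_line_continuous V W (f : V -> W) (x v : V) :
  derivable f x v -> {for 0, continuous (fun h : R => f (h *: v + x))}.
Proof.
by move=> /(derivable1P _ _ _).1 /derivable1_diffP /differentiable_continuous.
Qed.

Lemma is_derive_linear V W1 W2 (L : W1 -> W2) (f : V -> W1)
    (x v : V) (df : W1) :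
  linear L -> continuous L -> is_derive x v f df ->
  is_derive x v (L \o f) (L df).
Proof.
move=> linL contL [f_x f_v].
have [LZ LB] := linearZB linL.
have cv : (fun h => h^-1 *: (((L \o f) \o shift x) (h *: v) - (L \o f) x)) @ 0^'
    --> L df.
  rewrite [X in X @ _](_ : _ =
      L \o (fun h => h^-1 *: ((f \o shift x) (h *: v) - f x))); last first.
    apply/funext => h /=.
    by rewrite LZ LB.
  apply: cvg_comp; last exact: contL.
  by rewrite -f_v; exact: f_x.
by split; [apply/cvg_ex; exists (L df) | exact: cvg_lim cv].
Qed.

(** The product rule, at the generality that covers at once products of scalars,
scalar multiples of vectors and the metric. *)
Lemma is_derive_bilinear V W1 W2 W3 (B : W1 -> W2 -> W3)
    (f : V -> W1) (g : V -> W2) (x v : V) (df : W1) (dg : W2) :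
  continuous_bilinear B -> is_derive x v f df -> is_derive x v g dg ->
  is_derive x v (fun y => B (f y) (g y)) (B df (g x) + B (f x) dg).
Proof.
move=> [linr linl contB] [f_x f_v] [g_x g_v].
have BZr w a u : B w (a *: u) = a *: B w u.
  by have [+ _] := linearZB (linr w); apply.
have BBr w u u' : B w (u - u') = B w u - B w u'.
  by have [_ +] := linearZB (linr w); apply.
have BZl w a u : B (a *: u) w = a *: B u w.
  by have [+ _] := linearZB (linl w); apply.
have BBl w u u' : B (u - u') w = B u w - B u' w.
  by have [_ +] := linearZB (linl w); apply.
have cv : (fun h => h^-1 *: (((fun y => B (f y) (g y)) \o shift x) (h *: v) -
    B (f x) (g x))) @ 0^' --> B df (g x) + B (f x) dg.
  rewrite [X in X @ _](_ : _ = (fun h =>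
      B (h^-1 *: ((f \o shift x) (h *: v) - f x)) (g (h *: v + x)) +
      B (f x) (h^-1 *: ((g \o shift x) (h *: v) - g x)))); last first.
    apply/funext => h /=.
    by rewrite BZl BZr BBl BBr -scalerDr addrA subrK.
  apply: cvgD.
    apply: (cvg_comp2 _ _ (contB (df, g x))) => /=.
      by rewrite -f_v; exact: f_x.
    have /continuous_withinNx := derivable_line_continuous g_x.
    by rewrite scale0r add0r.
  apply: (cvg_comp2 _ _ (contB (f x, dg))) => /=; first exact: cvg_cst.
  by rewrite -g_v; exact: g_x.
by split; [apply/cvg_ex; eexists; exact: cv | exact: cvg_lim cv].
Qed.

End DirectionalDerivatives.

(** Only the restriction of [f] to the line through [x] in the direction [v]
enters, so this is the chain rule of one real variable. *)
Lemma is_derive_comp_real (R : realType) (V : normedModType R) (h : R -> R)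
    (f : V -> R) (x v : V) (dh df : R) :
  is_derive (f x) 1 h dh -> is_derive x v f df ->
  is_derive x v (h \o f) (dh * df).
Proof.
move=> hh [f_x f_v].
pose l (t : R) := f (t *: v + x).
have line (k : V -> R) : 'D_v k x = 'D_1 (fun t : R => k (t *: v + x)) 0.
  rewrite /derive; set g1 := (X in lim (X @ _)); set g2 := (X in _ = lim (X @ _)).
  suff -> : g1 = g2 by [].
  by apply/funext => t; rewrite /g1 /g2 /= addr0 scale0r add0r [_%:A]mulr1.
have dl : is_derive (0 : R) 1 l df.
  by split; [exact/(derivable1P _ _ _).1 | rewrite -line].
have hh' : is_derive (l 0) 1 h dh by rewrite /l scale0r add0r.
have [c1 c2] := is_derive1_comp hh' dl.
by split; [exact/(derivable1P _ _ _).2 | rewrite line].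
Qed.

(** * Closure properties of smoothness *)

Section Smoothness.
Context (R : realType).
Implicit Types V W : normedModType R.

Lemma CkW V W k (U : set V) (f : V -> W) : Ck k.+1 U f -> Ck k U f.
Proof.
elim: k f => [|k IH] f [fc fd]; split=> // v.
by have [? ?] := fd v; split=> //; exact: IH.
Qed.

Lemma Ck_continuous V W k (U : set V) (f : V -> W) :
  Ck k U f -> forall x, U x -> {for x, continuous f}.
Proof. by case: k => [|k] []. Qed.

(** Openness matters: the derivatives at a point of [U] see only [U]. *)
Lemma Ck_eq V W k (U : set V) (f g : V -> W) :
  open U -> {in U, f =1 g} -> Ck k U f -> Ck k U g.
Proof.
move=> oU.
have nfg (h1 h2 : V -> W) x : {in U, h1 =1 h2} -> U x -> \near x, h1 x = h2 x.
  by move=> h Ux; near=> y; apply: h; rewrite inE; near: y;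
    exact: open_nbhs_nbhs.
elim: k f g => [|k IH] f g fg [fc fd].
all: have gc x : U x -> {for x, continuous g} by move=> Ux;
  have fx : f @ x --> g x by [rewrite -(fg _ (mem_set Ux)); exact: fc];
  apply: cvg_trans fx; apply: near_eq_cvg; exact: nfg.
  by [].
split=> // v; have [d1 d2] := fd v; split.
  by move=> x Ux; apply: near_eq_derivable (d1 _ Ux); exact: nfg.
apply: (IH ('D_v f)) => // x; rewrite inE => Ux.
by apply: near_eq_derive; exact: nfg.
Unshelve. all: by end_near. Qed.

(** Lets an induction on [k] run on an explicit formula [Df] for the directional
derivatives in place of the operator ['D_v]. *)
Lemma is_derive_Ck V W k (U : set V) (f : V -> W) (Df : V -> V -> W) :
  open U -> (forall x, U x -> {for x, continuous f}) ->
  (forall x v, U x -> is_derive x v f (Df v x)) ->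
  (forall v, Ck k U (Df v)) -> Ck k.+1 U f.
Proof.
move=> oU fc fd Dfk; split=> // v; split.
  by move=> x Ux; have [] := fd x v Ux.
apply: (Ck_eq _ _ (Dfk v)) => // x; rewrite inE => Ux.
by have [_ ->] := fd x v Ux.
Qed.

Lemma Ck_cst V W k (U : set V) (w : W) : open U -> Ck k U (fun=> w).
Proof.
move=> oU; elim: k w => [|k IH] w; first by split=> // x _; exact: cvg_cst.
by apply: (is_derive_Ck (Df := fun _ _ => 0)) => // x ?; exact: cvg_cst.
Qed.

Lemma CkD V W k (U : set V) (f g : V -> W) :
  open U -> Ck k U f -> Ck k U g -> Ck k U (fun x => f x + g x).
Proof.
move=> oU; elim: k f g => [|k IH] f g fk gk.
all: have fgc x : U x -> {for x, continuous (fun x => f x + g x)} by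
  move=> Ux; apply: cvgD; [exact: (Ck_continuous fk)|exact: (Ck_continuous gk)].
  by [].
apply: (is_derive_Ck (Df := fun v x => 'D_v f x + 'D_v g x)) => //.
  move=> x v Ux; apply: is_deriveD; apply: derivableP.
    by have [_ /(_ v)[+ _]] := fk; apply.
  by have [_ /(_ v)[+ _]] := gk; apply.
move=> v; apply: IH.
  by have [_ /(_ v)[_ +]] := fk.
by have [_ /(_ v)[_ +]] := gk.
Qed.

Lemma Ck_linear V W k (U : set V) (L : V -> W) :
  open U -> linear L -> continuous L -> Ck k U L.
Proof.
move=> oU linL contL; case: k => [|k]; first by split=> // x _; exact: contL.
apply: (is_derive_Ck (Df := fun v _ => L v)) => //.
- by move=> x _; exact: contL.
- by move=> x v _; apply: (@is_derive_linear _ _ _ _ L id).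
- by move=> v; exact: Ck_cst.
Qed.

Lemma Ck_bilinear V W1 W2 W3 k (U : set V) (B : W1 -> W2 -> W3)
    (f : V -> W1) (g : V -> W2) :
  continuous_bilinear B -> open U -> Ck k U f -> Ck k U g ->
  Ck k U (fun x => B (f x) (g x)).
Proof.
move=> HB oU; elim: k f g => [|k IH] f g fk gk.
all: have fgc x : U x -> {for x, continuous (fun x => B (f x) (g x))} by
  move=> Ux; have [_ _ contB] := HB; apply: (cvg_comp2 _ _ (contB (f x, g x)));
  [exact: (Ck_continuous fk)|exact: (Ck_continuous gk)].
  by [].
apply: (is_derive_Ck (Df := fun v x => B ('D_v f x) (g x) + B (f x) ('D_v g x))) => //.
  move=> x v Ux; apply: is_derive_bilinear => //; apply: derivableP.
    by have [_ /(_ v)[+ _]] := fk; apply.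
  by have [_ /(_ v)[+ _]] := gk; apply.
move=> v; apply: CkD => //; apply: IH; do ?exact: CkW.
  by have [_ /(_ v)[_ +]] := fk.
by have [_ /(_ v)[_ +]] := gk.
Qed.

Lemma continuous_bilinear_scale W :
  continuous_bilinear (fun (a : R^o) (w : W) => a *: w).
Proof.
split=> [a b u v|w b u v|p].
- by rewrite scalerDr !scalerA mulrC.
- by rewrite scalerDl scalerA.
- exact: scale_continuous.
Qed.

Lemma continuous_bilinear_mul :
  continuous_bilinear (fun a b : R^o => a * b : R^o).
Proof. exact: (@continuous_bilinear_scale R^o). Qed.

(** The directional derivative is [- 1/2 'D_v q] times the cube of the function
itself, which closes the induction on [k]. *)
Lemma Ck_invsqrt V k (U : set V) (q : V -> R^o) :
  open U -> (forall x, U x -> 0 < q x) -> Ck k U q ->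
  Ck k U (fun x => (Num.sqrt (q x))^-1 : R^o).
Proof.
move=> oU q0; elim: k => [|k IH] qk.
all: have qc x : U x -> {for x, continuous (fun x => (Num.sqrt (q x))^-1 : R^o)} by
  move=> Ux; apply: cvgV; [rewrite gt_eqF// sqrtr_gt0 q0//|
  apply: (continuous_comp (Ck_continuous qk Ux)); exact: sqrt_continuous].
  by [].
apply: (is_derive_Ck (Df := fun v x => (- 2^-1 * 'D_v q x) *
  ((Num.sqrt (q x))^-1 * ((Num.sqrt (q x))^-1 * (Num.sqrt (q x))^-1)) : R^o)) => //.
  move=> x v Ux.
  have dq : is_derive x v q ('D_v q x).
    by apply: derivableP; have [_ /(_ v)[+ _]] := qk; apply.
  have sq0 : 0 < Num.sqrt (q x) by rewrite sqrtr_gt0 q0.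
  have ds := is_derive1_sqrt (q0 _ Ux).
  have ds' := is_derive_comp_real ds dq.
  have di : is_derive (Num.sqrt (q x)) 1 (fun y : R => y^-1) (- (Num.sqrt (q x)) ^- 2).
    split.
      by apply: (@derivableV _ _ id); rewrite ?gt_eqF.
    by rewrite (@deriveV _ _ id) ?gt_eqF// derive_id [_ *: _]mulr1.
  have dc := is_derive_comp_real (h := GRing.inv) (f := Num.sqrt \o q) di ds'.
  apply: (@is_derive_eq _ _ _ _ _ _ _ _ dc).
  by field; rewrite gt_eqF.
have ik := IH (CkW qk).
move=> v; apply: (Ck_bilinear continuous_bilinear_mul) => //.
  apply: (Ck_bilinear continuous_bilinear_mul) => //; first exact: Ck_cst.
  by have [_ /(_ v)[_ +]] := qk.
by do 2!apply: (Ck_bilinear continuous_bilinear_mul) => //.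
Qed.

(** The family is stable under differentiation; sine and cosine separately are
not, and the induction on [k] would not go through. *)
Lemma Ck_cos_sin k (a b th : R) :
  Ck k setT (fun t : R^o => a * cos (th * t) + b * sin (th * t) : R^o).
Proof.
have oT : open (setT : set R^o) by exact: openT.
have dcs (c d t v : R) : is_derive t v
    (fun t : R => c * cos (th * t) + d * sin (th * t) : R)
    ((d * th * v) * cos (th * t) + (- c * th * v) * sin (th * t)).
  have dth : is_derive t v (fun t : R => th * t) (th * v).
    by apply: (@is_deriveZ _ _ _ id).
  have dc := is_derive_comp_real (is_derive_cos (th * t)) dth.
  have ds := is_derive_comp_real (is_derive_sin (th * t)) dth.
  have := is_deriveD (is_deriveZ c dc) (is_deriveZ d ds).
  move=> H; apply: (@is_derive_eq _ _ _ _ _ _ _ _ H).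
  by rewrite /GRing.scale /=; ring.
have cts (c d t : R) : {for t, continuous (fun t : R => c * cos (th * t) + d * sin (th * t))}.
  by apply/differentiable_continuous/derivable1_diffP; have [] := dcs c d t 1.
elim: k a b => [|k IH] a b; first by split=> // t _; exact: cts.
apply: (is_derive_Ck (Df := fun v t =>
   (b * th * v) * cos (th * t) + (- a * th * v) * sin (th * t))) => //.
Qed.

End Smoothness.

Local Notation J := (cscale (iC _)).

(** * The complex structure and the Euclidean metric *)

Section HermitianSpace.
Context (R : realType) (n : nat).
Implicit Types (u v w z : cvec R n) (a : R).

(** Reduces identities between vectors to real polynomial or rational identities
between coordinates. *)
Lemma cvecP u v :
  (forall j, u.1 ord0 j = v.1 ord0 j /\ u.2 ord0 j = v.2 ord0 j) -> u = v.
Proof.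
case: u v => [u1 u2] [v1 v2] /= uv.
by congr pair; apply/rowP => j; have [? ?] := uv j.
Qed.

Lemma cscaleE (c : R[i]) u :
  c *c: u = complex.Re c *: u + complex.Im c *: J u.
Proof. by apply: cvecP => j; rewrite /= !mxE; split; ring. Qed.

Lemma J_linear : linear (cscale (iC R) : cvec R n -> cvec R n).
Proof. by move=> a u v; apply: cvecP => j; rewrite /= !mxE; split; ring. Qed.

Lemma JD u v : J (u + v) = J u + J v.
Proof. by rewrite -[u]scale1r J_linear !scale1r. Qed.

Lemma JZ a u : J (a *: u) = a *: J u.
Proof. by have [+ _] := linearZB J_linear; apply. Qed.

Lemma JK u : J (J u) = - u.
Proof. by apply: cvecP => j; rewrite /= !mxE; split; ring. Qed.

Lemma JN u : J (- u) = - J u.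
Proof. by rewrite -scaleN1r JZ scaleN1r. Qed.

Lemma J_inj : injective (cscale (iC R) : cvec R n -> cvec R n).
Proof. by move=> u v /(congr1 J); rewrite !JK => /oppr_inj. Qed.

Lemma cscaleJ (c : R[i]) u : c *c: J u = J (c *c: u).
Proof. by rewrite !(cscaleE c) JD !JZ. Qed.

Lemma cscaleDr (c : R[i]) u v : c *c: (u + v) = c *c: u + c *c: v.
Proof. by rewrite !(cscaleE c) JD !scalerDr addrACA. Qed.

Lemma cscaleZr (c : R[i]) a u : c *c: (a *: u) = a *: (c *c: u).
Proof.
by rewrite !(cscaleE c) JZ scalerDr !scalerA ![_ * a]mulrC.
Qed.

Lemma cscalerN (c : R[i]) u : c *c: (- u) = - (c *c: u).
Proof. by rewrite -scaleN1r cscaleZr scaleN1r. Qed.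

Lemma cscaleA (c d : R[i]) u : c *c: (d *c: u) = (c * d) *c: u.
Proof.
case: c d => [c1 c2] [d1 d2].
by apply: cvecP => j; rewrite /= !mxE; split; ring.
Qed.

Lemma metricE u v :
  metric u v = \sum_j (u.1 ord0 j * v.1 ord0 j + u.2 ord0 j * v.2 ord0 j).
Proof.
rewrite /metric /herm (big_morph (@complex.Re R) (id1 := 0) (op1 := +%R)) //=.
  by apply: eq_bigr => j _; rewrite mulrN opprK.
by move=> [x1 x2] [y1 y2].
Qed.

(** As [Im a = - Re (i a)], the Hermitian product is determined by the metric and
the complex structure; Hermitian orthogonality becomes two metric conditions. *)
Lemma hermE u v : herm u v = metric u v +i* (- metric (J u) v).
Proof.
have -> : herm u v = complex.Re (herm u v) +i* complex.Im (herm u v).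
  by case: (herm u v).
congr (_ +i* _); rewrite metricE /herm.
rewrite (big_morph (@complex.Im R) (id1 := 0) (op1 := +%R)) //=.
  by rewrite -sumrN; apply: eq_bigr => j _; rewrite !mxE; ring.
by move=> [x1 x2] [y1 y2].
Qed.

Lemma metricC u v : metric u v = metric v u.
Proof. by rewrite !metricE; apply: eq_bigr => j _; ring. Qed.

Lemma metricDl u v w : metric (u + v) w = metric u w + metric v w.
Proof.
by rewrite !metricE -big_split /=; apply: eq_bigr => j _; rewrite !mxE; ring.
Qed.

Lemma metricZl a u w : metric (a *: u) w = a * metric u w.
Proof.
by rewrite !metricE mulr_sumr; apply: eq_bigr => j _; rewrite /= !mxE; ring.
Qed.

Lemma metricDr u v w : metric w (u + v) = metric w u + metric w v.
Proof. by rewrite metricC metricDl ![metric _ w]metricC. Qed.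

Lemma metricZr a u w : metric w (a *: u) = a * metric w u.
Proof. by rewrite metricC metricZl metricC. Qed.

Lemma metricNl u w : metric (- u) w = - metric u w.
Proof. by rewrite -scaleN1r metricZl mulN1r. Qed.

Lemma metricNr u w : metric w (- u) = - metric w u.
Proof. by rewrite metricC metricNl metricC. Qed.

Lemma herm_eq0P u v : herm u v = 0 <-> metric u v = 0 /\ metric (J u) v = 0.
Proof.
rewrite hermE; split=> [[-> /eqP]|[-> ->]]; last by rewrite oppr0.
by rewrite oppr_eq0 => /eqP ->.
Qed.

Definition metric_bilin :=
  (metricDl, metricDr, metricZl, metricZr, metricNl, metricNr).

Lemma metricJ u v : metric (J u) v = - metric u (J v).
Proof.
by rewrite !metricE -sumrN; apply: eq_bigr => j _; rewrite /= !mxE; ring.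
Qed.

Lemma metricJJ u v : metric (J u) (J v) = metric u v.
Proof. by rewrite metricJ JK metricNr opprK. Qed.

Lemma metricJ_self u : metric (J u) u = 0.
Proof.
by rewrite metricE big1// => j _; rewrite /= !mxE; ring.
Qed.

Lemma metric_ge0 u : 0 <= metric u u.
Proof.
by rewrite metricE; apply: sumr_ge0 => j _; rewrite -!expr2 addr_ge0// sqr_ge0.
Qed.

Lemma metric_eq0 u : metric u u = 0 -> u = 0.
Proof.
rewrite metricE => /eqP; rewrite psumr_eq0; last first.
  by move=> j _; rewrite -!expr2 addr_ge0// sqr_ge0.
move=> /allP u0; apply: cvecP => j; rewrite !mxE.
have := u0 j; rewrite mem_index_enum => /(_ isT).
by rewrite -!expr2 paddr_eq0 ?sqr_ge0// !sqrf_eq0 => /andP[/eqP -> /eqP ->].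
Qed.

Lemma enorm_sqr u : enorm u ^+ 2 = metric u u.
Proof. by rewrite /enorm sqr_sqrtr// metric_ge0. Qed.

Lemma enorm_ge0 u : 0 <= enorm u. Proof. exact: sqrtr_ge0. Qed.

Lemma enorm1P u : enorm u = 1 <-> metric u u = 1.
Proof.
rewrite -enorm_sqr; split=> [->|/eqP]; first by rewrite expr1n.
by rewrite sqrf_eq1 => /orP[/eqP//|/eqP h]; have := enorm_ge0 u; rewrite h; lra.
Qed.

Lemma coord1_continuous (j : 'I_n.+1) : continuous (fun u : cvec R n => u.1 ord0 j).
Proof.
by move=> u; apply: (@continuous_comp _ _ _ fst (fun M : 'rV[R]_n.+1 => M ord0 j));
  [exact: cvg_fst|exact: coord_continuous].
Qed.

Lemma coord2_continuous (j : 'I_n.+1) : continuous (fun u : cvec R n => u.2 ord0 j).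
Proof.
by move=> u; apply: (@continuous_comp _ _ _ snd (fun M : 'rV[R]_n.+1 => M ord0 j));
  [exact: cvg_snd|exact: coord_continuous].
Qed.

Lemma metric_continuous_bilinear :
  continuous_bilinear (@metric R n : cvec R n -> cvec R n -> R^o).
Proof.
split=> [w a u v|w a u v|p].
- by rewrite metricDr metricZr.
- by rewrite metricDl metricZl.
pose F j (q : cvec R n * cvec R n) :=
  q.1.1 ord0 j * q.2.1 ord0 j + q.1.2 ord0 j * q.2.2 ord0 j.
have -> : (fun q : cvec R n * cvec R n => metric q.1 q.2) =
    (fun q => \sum_j F j q) by apply/funext => q; rewrite metricE.
rewrite /continuous_at.
elim: (index_enum _) => [|j r IH].
  rewrite big_nil (_ : (fun=> _) = fun=> 0); first exact: cvg_cst.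
  by apply/funext => q; rewrite big_nil.
rewrite big_cons (_ : (fun=> _) = fun q => F j q + \sum_(i <- r) F i q); last first.
  by apply/funext => q; rewrite big_cons.
apply: cvgD; last exact: IH.
apply: cvgD; apply: cvgM.
- by apply: (@continuous_comp _ _ _ fst (fun u : cvec R n => u.1 ord0 j));
    [exact: cvg_fst|exact: coord1_continuous].
- by apply: (@continuous_comp _ _ _ snd (fun u : cvec R n => u.1 ord0 j));
    [exact: cvg_snd|exact: coord1_continuous].
- by apply: (@continuous_comp _ _ _ fst (fun u : cvec R n => u.2 ord0 j));
    [exact: cvg_fst|exact: coord2_continuous].
- by apply: (@continuous_comp _ _ _ snd (fun u : cvec R n => u.2 ord0 j));
    [exact: cvg_snd|exact: coord2_continuous].
Qed.

Lemma J_continuous : continuous (cscale (iC R) : cvec R n -> cvec R n).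
Proof.
have -> : cscale (iC R) = (fun u : cvec R n => (- u.2, u.1)).
  by apply/funext => u; apply: cvecP => j; rewrite /= !mxE; split; ring.
move=> u; apply: (@cvg_pair _ _ _ (nbhs u) (nbhs (- u.2)) (nbhs u.1)).
  by apply: cvgN; exact: cvg_snd.
exact: cvg_fst.
Qed.

End HermitianSpace.

(** * Curves on Clifford tori and linear differential equations *)

Section CliffordCurves.
Context (R : realType) (n : nat).
Implicit Types (u v w z : cvec R n) (a b t : R).

Lemma expiD a b : expi (a + b) = expi a * expi b.
Proof. by rewrite /expi cosD sinD /=; simpc; congr (_ +i* _); ring. Qed.

Lemma expi0 : expi (0 : R) = 1.
Proof. by rewrite /expi cos0 sin0. Qed.

Lemma norm_expi a : `|expi a| = 1.
Proof. by rewrite normc_def /= cos2Dsin2 sqrtr1. Qed.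

Lemma cscale1 u : 1 *c: u = u.
Proof. by rewrite cscaleE scale1r scale0r addr0. Qed.

Lemma cscaler0 (c : R[i]) : c *c: (0 : cvec R n) = 0.
Proof. by rewrite -[X in _ *c: X](scale0r 0) cscaleZr scale0r. Qed.

Lemma expi_cscale a u : expi a *c: u = cos a *: u + sin a *: J u.
Proof. exact: cscaleE. Qed.

Lemma expi_cscaleK a : cancel (cscale (expi a)) (cscale (expi (- a)) : cvec R n -> _).
Proof.
by move=> u; rewrite cscaleA -expiD addNr expi0 cscale1.
Qed.

Lemma expi_cscaleVK a : cancel (cscale (expi (- a))) (cscale (expi a) : cvec R n -> _).
Proof. by move=> u; rewrite -{1}[a]opprK expi_cscaleK. Qed.

Lemma metric_expi a u v : metric (expi a *c: u) (expi a *c: v) = metric u v.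
Proof.
rewrite !expi_cscale !metric_bilin metricJJ metricJ.
by rewrite -[RHS]mul1r -(cos2Dsin2 a); ring.
Qed.

Lemma metric_expi_orthogonal a b u v : herm u v = 0 ->
  metric (expi a *c: u) (expi b *c: v) = 0.
Proof.
move=> /herm_eq0P[uv Juv].
rewrite !expi_cscale !metric_bilin metricJJ.
have -> : metric u (J v) = 0 by rewrite -[LHS]opprK -metricJ Juv oppr0.
by rewrite uv Juv; ring.
Qed.

(** In a frame rotating at speed [a] the derivative acquires the term [a i f]; the
choice of [a] that cancels [f'] turns a first order equation into constancy. *)
Lemma is_derive_expi a (f : R -> cvec R n) t (df : cvec R n) :
  is_derive t 1 f df ->
  is_derive t 1 (fun x => expi (a * x) *c: f x) (expi (a * t) *c: (df + a *: J (f t))).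
Proof.
move=> f_t.
have da : is_derive t (1 : R) (fun x : R => a * x) a.
  have H : is_derive t (1 : R) (fun x : R => a * x) (a * 1).
    exact: (@is_deriveZ _ _ _ id).
  by rewrite mulr1 in H.
have dc := is_derive_comp_real (is_derive_cos (a * t)) da.
have ds := is_derive_comp_real (is_derive_sin (a * t)) da.
have HS := @continuous_bilinear_scale R (cvec R n).
have dJ := is_derive_linear (@J_linear R n) (@J_continuous R n) f_t.
have H := is_deriveD (is_derive_bilinear HS dc f_t) (is_derive_bilinear HS ds dJ).
have -> : (fun x => expi (a * x) *c: f x) =
   (fun x => (cos \o (fun x => a * x)) x *: f x) +
   (fun x => (sin \o (fun x => a * x)) x *: (J \o f) x).
  by apply/funext => x; rewrite expi_cscale.
apply: (@is_derive_eq _ _ _ _ _ _ _ _ H).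
rewrite expi_cscale JD JZ JK /=.
by apply: cvecP => j; rewrite /= !mxE; split; ring.
Qed.

Lemma is_derive_cst_vector (f : R -> cvec R n) :
  (forall t, is_derive t 1 f 0) -> forall t, f t = f 0.
Proof.
move=> df t; apply: cvecP => j; split.
  apply: (@is_derive_0_is_cst _ (fun t => (f t).1 ord0 j)) => x.
  have lin : linear (fun u : cvec R n => u.1 ord0 j : R^o).
    by move=> a u v; rewrite /= !mxE.
  have := is_derive_linear lin (@coord1_continuous R n j) (df x).
  by rewrite mxE.
apply: (@is_derive_0_is_cst _ (fun t => (f t).2 ord0 j)) => x.
have lin : linear (fun u : cvec R n => u.2 ord0 j : R^o).
  by move=> a u v; rewrite /= !mxE.
have := is_derive_linear lin (@coord2_continuous R n j) (df x).
by rewrite mxE.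
Qed.


Definition torus_curve a b w0 w1 t : cvec R n :=
  expi (a * t) *c: w0 + expi (b * t) *c: w1.

(** Differentiation keeps the two frequencies and acts on the two vectors, so
all derivatives of these curves are again curves of the same kind. *)
Lemma is_derive_torus_curve a b w0 w1 t :
  is_derive t 1 (torus_curve a b w0 w1)
    (torus_curve a b (a *: J w0) (b *: J w1) t).
Proof.
have d0 := @is_derive_expi a (fun=> w0) t 0 (is_derive_cst _ _ _).
have d1 := @is_derive_expi b (fun=> w1) t 0 (is_derive_cst _ _ _).
by have := is_deriveD d0 d1; rewrite !add0r.
Qed.

Lemma derive1_torus_curve a b w0 w1 :
  derive1 (torus_curve a b w0 w1) = torus_curve a b (a *: J w0) (b *: J w1).
Proof.
by apply/funext => t; rewrite derive1E; have [_] := is_derive_torus_curve a b w0 w1 t.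
Qed.

Lemma smooth_torus_curve a b w0 w1 :
  smooth setT (torus_curve a b w0 w1 : R^o -> cvec R n).
Proof.
have sm (c : R) w : smooth setT (fun t : R^o => expi (c * t) *c: w).
  move=> k.
  have E : {in [set: R^o], (fun t : R^o => (1 * cos (c * t) + 0 * sin (c * t)) *: w +
      (0 * cos (c * t) + 1 * sin (c * t)) *: J w) =1
      (fun t : R^o => expi (c * t) *c: w)}.
    by move=> t _; rewrite expi_cscale !mul1r !mul0r addr0 add0r.
  apply: (Ck_eq _ E); first exact: openT.
  apply: CkD; first exact: openT.
    apply: (Ck_bilinear (@continuous_bilinear_scale R _)); first exact: openT.
      exact: Ck_cos_sin.
    by apply: Ck_cst; exact: openT.
  apply: (Ck_bilinear (@continuous_bilinear_scale R _)); first exact: openT.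
    exact: Ck_cos_sin.
  by apply: Ck_cst; exact: openT.
by move=> k; apply: CkD; [exact: openT|exact: sm|exact: sm].
Qed.

(** Under the orthogonality conditions the mixed terms, the only ones that
depend on [t], vanish. *)
Lemma metric_torus_curve a b w0 w1 u0 u1 t :
  herm w0 u1 = 0 -> herm w1 u0 = 0 ->
  metric (torus_curve a b w0 w1 t) (torus_curve a b u0 u1 t) =
  metric w0 u0 + metric w1 u1.
Proof.
move=> h0 h1; rewrite /torus_curve !metric_bilin !metric_expi.
by rewrite !metric_expi_orthogonal//; ring.
Qed.

Lemma first_order_ode a (f : R -> cvec R n) :
  (forall t, is_derive t 1 f (a *: J (f t))) ->
  forall t, f t = expi (a * t) *c: f 0.
Proof.
move=> df t; pose F t := expi (- a * t) *c: f t.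
have dF (x : R) : is_derive x 1 F 0.
  have := is_derive_expi (- a) (df x).
  by rewrite scaleNr subrr cscaler0.
have := is_derive_cst_vector dF t; rewrite /F mulr0 expi0 cscale1.
by move=> <-; rewrite mulNr expi_cscaleVK.
Qed.

(** The operator splits as [(D - i a)(D - i b) = (D - i b)(D - i a)].  Either order
gives a first order equation, for [f' - i b f] and [f' - i a f] respectively; the
difference of their solutions is [(a - b) i f]. *)
Lemma second_order_ode a b (f f' f'' : R -> cvec R n) w0 w1 : a != b ->
  (forall t, is_derive t 1 f (f' t)) -> (forall t, is_derive t 1 f' (f'' t)) ->
  (forall t, f'' t = (a + b) *: J (f' t) + (a * b) *: f t) ->
  f 0 = w0 + w1 -> f' 0 = a *: J w0 + b *: J w1 ->
  forall t, f t = torus_curve a b w0 w1 t.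
Proof.
move=> ab df df' ode f0 f'0 t.
have factor (c d : R) : c + d = a + b -> c * d = a * b ->
    f' t - c *: J (f t) = expi (d * t) *c: (f' 0 - c *: J (f 0)).
  move=> cd1 cd2.
  apply: (@first_order_ode d (fun x => f' x - c *: J (f x))) => x.
  have dJ := is_derive_linear (@J_linear R n) (@J_continuous R n) (df x).
  have H := is_deriveB (df' x) (is_deriveZ c dJ).
  apply: (@is_derive_eq _ _ _ _ _ _ _ _ H).
  rewrite ode JD JN JZ JK -cd1 -cd2.
  by apply: cvecP => j; rewrite /= !mxE; split; ring.
have := factor a b erefl erefl.
have := factor b a (addrC _ _) (mulrC _ _).
rewrite f0 f'0 => ea eb.
have {}ea : f' t - b *: J (f t) = (a - b) *: J (expi (a * t) *c: w0).
  rewrite ea -cscaleJ -[RHS]cscaleZr; congr (_ *c: _).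
  by rewrite JD; apply: cvecP => j; rewrite /= !mxE; split; ring.
have {}eb : f' t - a *: J (f t) = (b - a) *: J (expi (b * t) *c: w1).
  rewrite eb -cscaleJ -[RHS]cscaleZr; congr (_ *c: _).
  by rewrite JD; apply: cvecP => j; rewrite /= !mxE; split; ring.
(* i f is the difference of the two first order solutions, divided by a - b. *)
apply: J_inj; have abn : a - b != 0 by rewrite subr_eq0.
apply: (scalerI abn).
have -> : (a - b) *: J (f t) = (f' t - b *: J (f t)) - (f' t - a *: J (f t)).
  by apply: cvecP => j; rewrite /= !mxE; split; ring.
rewrite ea eb JD.
by apply: cvecP => j; rewrite /= !mxE; split; ring.
Qed.

End CliffordCurves.

(** * The magnetic geodesic equation *)

Section MagneticGeodesics.
Context (R : realType) (n : nat).
Implicit Types (u v w z : cvec R n) (s t : R).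

(** The form [alpha] is linear in the base point, and its two derivatives differ
by a sign since [i] is skew; this cancels the factor [1 / 2]. *)
Lemma ext_deriv_alpha z u v : ext_deriv (@alpha R n) z u v = metric (J u) v.
Proof.
have d u' v' : 'D_u' (fun x => alpha x v' : R^o) z = 2^-1 * metric (J u') v'.
  have lin : linear (fun x : cvec R n => alpha x v' : R^o).
    move=> a x y; rewrite /alpha JD JZ !metric_bilin /GRing.scale /=; ring.
  have cont : continuous (fun x : cvec R n => alpha x v' : R^o).
    move=> x; apply: cvgM; first exact: cvg_cst.
    have [_ _ mc] := @metric_continuous_bilinear R n.
    by apply: (cvg_comp2 _ _ (mc (J x, v'))); [exact: J_continuous|exact: cvg_cst].
  by have [_] := is_derive_linear lin cont (@is_derive_id _ _ z u').
rewrite /ext_deriv !d [metric (J v) u]metricC [metric u (J v)]metricC.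
rewrite [metric (J v) u]metricJ [metric v (J u)]metricC; lra.
Qed.

Definition magnetic_force s z u : cvec R n :=
  s *: (J u - metric (J u) z *: z).

Lemma magnetic_force_lorentz s :
  lorentz_force (fun z u v => s * ext_deriv (@alpha R n) z u v) (magnetic_force s).
Proof.
move=> z u /enorm1P zz zu; split.
  by rewrite /tangent /= !metric_bilin zz [metric z (J u)]metricC; ring.
by move=> v zv; rewrite ext_deriv_alpha !metric_bilin [metric z v]zv; ring.
Qed.

(** The metric is nondegenerate on each tangent space: the difference of two
force fields is tangent and orthogonal to every tangent vector, hence to itself. *)
Lemma lorentz_force_unique sigma (Y Y' : cvec R n -> cvec R n -> cvec R n) z u :
  lorentz_force sigma Y -> lorentz_force sigma Y' ->
  sphere z -> tangent z u -> Y z u = Y' z u.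
Proof.
move=> HY HY' zz zu; have [t1 e1] := HY _ _ zz zu; have [t2 e2] := HY' _ _ zz zu.
have tD : tangent z (Y z u - Y' z u).
  by rewrite /tangent /= metricDr metricNr t1 t2 subrr.
apply/eqP; rewrite -subr_eq0; apply/eqP/metric_eq0.
by rewrite metricDl metricNl e1// e2// subrr.
Qed.

Lemma is_derive_metric (f g : R -> cvec R n) t df dg :
  is_derive t 1 f df -> is_derive t 1 g dg ->
  is_derive t 1 (fun x => metric (f x) (g x) : R) (metric df (g t) + metric (f t) dg).
Proof. exact: is_derive_bilinear (@metric_continuous_bilinear R n). Qed.

(** Differentiating [g(gamma, gamma) = 1] twice gives the normal part [-1] of
[gamma'']; the tangential part is the force.  The coefficient of [gamma] involves
[g(i gamma, gamma')], which is conserved because both terms of [gamma''] are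
orthogonal to [i gamma], the first one as [g(gamma, gamma') = 0]. *)
Lemma magnetic_geodesic_ode s gamma z v :
  magnetic_geodesic_of_strength s gamma -> gamma 0 = z -> derive1 gamma 0 = v ->
  [/\ forall t, is_derive t 1 gamma (derive1 gamma t),
      forall t, is_derive t 1 (derive1 gamma) (derive1 (derive1 gamma) t) &
      forall t, derive1 (derive1 gamma) t =
        s *: J (derive1 gamma t) + (s * metric (J z) v - 1) *: gamma t].
Proof.
move=> [[sm sph [Y [HY geo]]] speed] g0 v0.
have d1 t : is_derive t 1 gamma (derive1 gamma t).
  rewrite derive1E; apply: derivableP.
  by have [_ /(_ 1)[+ _]] := sm 1%N; apply.
have dE : derive1 gamma = 'D_1 gamma by apply/funext => t; rewrite derive1E.
have d2 t : is_derive t 1 (derive1 gamma) (derive1 (derive1 gamma) t).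
  rewrite [X in is_derive _ _ _ X]derive1E; apply: derivableP; rewrite dE.
  by have [_ /(_ 1)[_ [_ /(_ 1)[+ _]]]] := sm 2%N; apply.
have gg t : metric (gamma t) (gamma t) = 1 by apply/enorm1P/sph.
have g'g' t : metric (derive1 gamma t) (derive1 gamma t) = 1 by apply/enorm1P/speed.
have gg' t : metric (gamma t) (derive1 gamma t) = 0.
  have [_] := is_derive_metric (d1 t) (d1 t).
  rewrite (_ : (fun _ => _) = cst 1); last by apply/funext => x; exact: gg.
  by rewrite derive_cst [X in X + _]metricC; lra.
have gg'' t : metric (gamma t) (derive1 (derive1 gamma) t) = -1.
  have [_] := is_derive_metric (d1 t) (d2 t).
  rewrite (_ : (fun _ => _) = cst 0); last by apply/funext => x; exact: gg'.
  by rewrite derive_cst g'g'; lra.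
have ode t : derive1 (derive1 gamma) t = s *: J (derive1 gamma t) +
    (s * metric (J (gamma t)) (derive1 gamma t) - 1) *: gamma t.
  have := geo t.
  rewrite (lorentz_force_unique HY (@magnetic_force_lorentz s) (sph t) (gg' t)).
  rewrite /cov_deriv /magnetic_force gg'' => /(canRL (subrK _)) ->.
  rewrite metricC -[metric (gamma t) _]opprK -metricJ.
  by apply: cvecP => j; rewrite /= !mxE; split; ring.
have angle t : metric (J (gamma t)) (derive1 gamma t) = metric (J z) v.
  rewrite -g0 -v0.
  apply: (@is_derive_0_is_cst _ (fun t => metric (J (gamma t)) (derive1 gamma t))) => x.
  have dJ := is_derive_linear (@J_linear R n) (@J_continuous R n) (d1 x).
  apply: (@is_derive_eq _ _ _ _ _ _ _ _ (is_derive_metric dJ (d2 x))).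
  by rewrite ode /= !metric_bilin metricJJ !metricJ_self gg' !mulr0 !addr0.
split; [exact: d1|exact: d2|move=> t].
by rewrite ode angle.
Qed.

End MagneticGeodesics.

(** * The contact angle and the vector C_s *)

Section ContactAngle.
Context (R : realType).
Implicit Types (s psi : R).

(** The Cauchy-Schwarz inequality puts the argument of [acos] between [-1] and [1],
where [acos] inverts the cosine. *)
Lemma contact_angleP (n : nat) (z v : cvec R n) : unit_tangent z v ->
  cos (contact_angle z v) = metric (J z) v /\ 0 <= contact_angle z v <= pi.
Proof.
move=> [/enorm1P zz zv /enorm1P vv].
(* This vector is the component of i z orthogonal to v: squared norm 1 - k ^ 2. *)
have := metric_ge0 (J z - metric (J z) v *: v).
rewrite !metric_bilin metricJJ zz vv [metric v (J z)]metricC => CS.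
have k1 : -1 <= metric (J z) v <= 1 by apply/andP; split; nra.
by split; [rewrite /contact_angle acosK// in_itv|rewrite acos_ge0// acos_lepi].
Qed.

Lemma norm2_Cs_sqr s psi :
  norm2 (Cs s psi) ^+ 2 = 1 - s * cos psi + s ^+ 2 / 4.
Proof.
by rewrite /norm2 sqr_sqrtr ?addr_ge0 ?sqr_ge0//= sin2cos2; field.
Qed.

Lemma norm2_CsE s psi :
  norm2 (Cs s psi) = Num.sqrt (1 - s * cos psi + s ^+ 2 / 4).
Proof. by rewrite -norm2_Cs_sqr sqrtr_sqr ger0_norm// sqrtr_ge0. Qed.

(** The squared norm is [(s / 2 - cos psi)^2 + sin^2 psi]; it vanishes only if
[cos psi] is [1] or [-1] and equal to [s / 2 >= 0]. *)
Lemma norm2_Cs_gt0 s psi : 0 <= s -> 0 <= psi <= pi -> ~ (s = 2 /\ psi = 0) ->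
  0 < norm2 (Cs s psi).
Proof.
move=> s0 psiB not_pole; rewrite lt_def sqrtr_ge0 andbT; apply/eqP => c0.
apply: not_pole; have := norm2_Cs_sqr s psi; rewrite c0 => e.
have h1 := cos_geN1 psi; have h2 := cos_le1 psi.
have h3 := sqr_ge0 (s / 2 - cos psi).
have cos1 : cos psi = 1.
  have : (cos psi - 1) * (cos psi + 1) = 0 by nra.
  by move=> /eqP; rewrite mulf_eq0 => /orP[] /eqP h; nra.
split.
  have : (s - 2) ^+ 2 = 0 by move: e; rewrite cos1; nra.
  by move=> /eqP; rewrite sqrf_eq0 subr_eq0 => /eqP.
by rewrite -(@cosK _ psi) ?in_itv//= cos1 acos1.
Qed.

Lemma norm2_ratio (p : R * R) : -1 <= p.1 / norm2 p <= 1.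
Proof.
have := sqrtr_ge0 (p.1 ^+ 2 + p.2 ^+ 2); rewrite -/(norm2 p) le_eqVlt.
move=> /orP[/eqP <-|c0]; first by rewrite invr0 mulr0; lra.
rewrite ler_pdivlMr// ler_pdivrMr// mulN1r mul1r -ler_norml.
by rewrite -sqrtr_sqr /norm2 ler_sqrt ?addr_ge0 ?sqr_ge0// lerDl sqr_ge0.
Qed.

Lemma Arg_ge0_lepi (p : R * R) : 0 <= Arg p <= pi.
Proof.
rewrite /Arg; case: eqP => [_|_]; first by have := pi_ge0 R; lra.
by rewrite acos_ge0 ?acos_lepi ?norm2_ratio.
Qed.

(** The product form holds at the origin too, whatever angle is chosen there. *)
Lemma norm2_cos_Arg (p : R * R) : norm2 p * cos (Arg p) = p.1.
Proof.
rewrite /Arg; case: eqP => [->/=|p0]; first by rewrite cos_pihalf mulr0.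
have c0 : norm2 p != 0.
  rewrite gt_eqF// sqrtr_gt0 lt_def addr_ge0 ?sqr_ge0// andbT paddr_eq0 ?sqr_ge0//.
  rewrite !sqrf_eq0; apply/negP => /andP[/eqP p1 /eqP p2]; apply: p0.
  by case: p p1 p2 => ? ? /= -> ->.
by rewrite acosK ?in_itv/= ?norm2_ratio// mulrC divfK.
Qed.

End ContactAngle.

(** * Admissible pairs and the geodesics they determine *)

Section AdmissiblePairs.
Context (R : realType) (n : nat).
Implicit Types (w z v : cvec R n) (s psi c : R).

(** For an admissible pair the width conditions on the two norms are equivalent
to one condition on their squares, by the half-angle formula. *)
Lemma pair_widthP w0 w1 tau : admissible w0 w1 -> 0 <= tau <= pi ->
  pair_width w1 w0 tau <-> metric w1 w1 - metric w0 w0 = cos tau.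
Proof.
move=> [_]; rewrite !enorm_sqr => w01 tauB.
have half : cos tau = cos (tau / 2) ^+ 2 - sin (tau / 2) ^+ 2.
  by rewrite {1}[tau]splitr cosD -!expr2.
split=> [[_ e1 e0]|e]; first by rewrite -!enorm_sqr e0 e1 half.
have c1 := cos2Dsin2 (tau / 2).
have ch : 0 <= cos (tau / 2) by apply: cos_ge0_pihalf; lra.
have sh : 0 <= sin (tau / 2) by apply: sin_ge0_pi; lra.
split=> //; rewrite /enorm -[RHS]ger0_norm// -sqrtr_sqr; congr Num.sqrt; lra.
Qed.

Lemma admissible_sym w0 w1 : admissible w0 w1 -> admissible w1 w0.
Proof.
move=> [/herm_eq0P[e0 e1] w01]; split; last by rewrite addrC.
by apply/herm_eq0P; rewrite metricC e0 metricJ metricC e1 oppr0.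
Qed.

Lemma clifford_torus_sym w0 w1 : clifford_torus w0 w1 = clifford_torus w1 w0.
Proof.
by apply/seteqP; split=> z [l0 [l1 [? ? ->]]]; exists l1, l0; rewrite addrC.
Qed.

Lemma torus_curve_in a b w0 w1 t : clifford_torus w0 w1 (torus_curve a b w0 w1 t).
Proof. by exists (expi (a * t)), (expi (b * t)); rewrite !norm_expi. Qed.

Lemma geodesic_formE s psi w0 w1 (gamma : R -> cvec R n) :
  geodesic_form s psi w0 w1 gamma <->
  gamma = torus_curve (s / 2 - norm2 (Cs s psi)) (s / 2 + norm2 (Cs s psi)) w0 w1.
Proof.
have e t : torus_curve (s / 2 - norm2 (Cs s psi)) (s / 2 + norm2 (Cs s psi)) w0 w1 t =
  expi (s / 2 * t) *c: (expi (- (norm2 (Cs s psi) * t)) *c: w0 +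
                          expi (norm2 (Cs s psi) * t) *c: w1).
  by rewrite cscaleDr !cscaleA -!expiD /torus_curve mulrBl mulrDl.
by split=> [g|-> t]; [apply/funext => t; rewrite e|rewrite e].
Qed.

(** With [pair1], the solution of [z = w0 + w1], [v = i (th0 w0 + th1 w1)] for the
frequencies [s / 2 - c] and [s / 2 + c], arranged so that the dependence on [c]
is only through real multiples of [1 / c]. *)
Definition pair0 s c z v : cvec R n :=
  (2^-1 + s / (4 * c)) *: z + (2 * c)^-1 *: J v.

Definition pair1 s c z v : cvec R n :=
  (2^-1 - s / (4 * c)) *: z - (2 * c)^-1 *: J v.

Lemma iC_real_cscale (a : R) w0 : (iC R * a%:C) *c: w0 = a *: J w0.
Proof. by apply: cvecP => j; rewrite /= !mxE; split; ring. Qed.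

Lemma iC_inv_cscale c w0 : c != 0 ->
  (2 * iC R * c%:C)^-1 *c: w0 = - (2 * c)^-1 *: J w0.
Proof.
move=> c0; have -> : (2 * iC R * c%:C)^-1 = iC R * (- (2 * c)^-1)%:C.
  have e : (2 * iC R * c%:C) * (iC R * (- (2 * c)^-1)%:C) = 1.
    by rewrite /iC; apply/eqP; rewrite eq_complex /=; apply/andP; split; apply/eqP; field.
  have /eqP u0 : 2 * iC R * c%:C != 0.
    by apply/eqP => h; move: e; rewrite h mul0r => /eqP; rewrite eq_sym oner_eq0.
  by apply: (mulfI (introN eqP u0)); rewrite e mulfV//; apply/eqP.
exact: iC_real_cscale.
Qed.

Lemma pair0E s c z v : c != 0 ->
  (2 * iC R * c%:C)^-1 *c: ((iC R * (c + s / 2)%:C) *c: z - v) = pair0 s c z v.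
Proof.
move=> c0; rewrite iC_inv_cscale// iC_real_cscale JD JN JZ JK.
by apply: cvecP => j; rewrite /= !mxE; split; field.
Qed.

Lemma pair1E s c z v : c != 0 ->
  (2 * iC R * c%:C)^-1 *c: ((iC R * (c - s / 2)%:C) *c: z + v) = pair1 s c z v.
Proof.
move=> c0; rewrite iC_inv_cscale// iC_real_cscale JD JZ JK.
by apply: cvecP => j; rewrite /= !mxE; split; field.
Qed.

Lemma pair_position s c z v : z = pair0 s c z v + pair1 s c z v.
Proof.
rewrite /pair0 /pair1; move: (s / (4 * c)) (2 * c)^-1 => x y.
by apply: cvecP => j; rewrite /= !mxE; split; field.
Qed.

Lemma pair_velocity s c z v : c != 0 ->
  v = (s / 2 - c) *: J (pair0 s c z v) + (s / 2 + c) *: J (pair1 s c z v).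
Proof.
move=> c0; rewrite /pair0 /pair1 !JD !JN !JZ JK.
by apply: cvecP => j; rewrite /= !mxE; split; field.
Qed.

(** With [|z| = |v| = 1] and [z] orthogonal to [v], the product [g(w0, w1)] is a
multiple of [4 c^2 - s^2 - 4 + 4 k s], so it vanishes exactly because [c] is the
norm of [C_s]; then [|w0|^2 + |w1|^2 = |z|^2]. *)
Lemma pair_admissible s c z v : unit_tangent z v -> c != 0 ->
  c ^+ 2 = 1 - s * metric (J z) v + s ^+ 2 / 4 ->
  [/\ admissible (pair0 s c z v) (pair1 s c z v) &
      c * (metric (pair1 s c z v) (pair1 s c z v) -
           metric (pair0 s c z v) (pair0 s c z v)) = metric (J z) v - s / 2].
Proof.
move=> [/enorm1P zz zv /enorm1P vv] c0 c2.
have zJv : metric z (J v) = - metric (J z) v by rewrite metricJ opprK.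
have Jvz : metric (J v) z = - metric (J z) v by rewrite metricC.
have vz : metric v z = 0 by rewrite metricC.
have h0 : metric (pair0 s c z v) (pair1 s c z v) = 0.
  rewrite /pair0 /pair1 !metric_bilin metricJJ zz vv zJv Jvz.
  transitivity ((4 * c ^+ 2 - s ^+ 2 - 4 + 4 * metric (J z) v * s) / (16 * c ^+ 2)).
    by field.
  by rewrite {1}c2; field.
split; first split.
- apply/herm_eq0P; rewrite h0; split=> //.
  rewrite /pair0 /pair1 JD !JZ JK !metric_bilin metricJJ !metricJ_self.
  have vJv : metric v (J v) = 0 by rewrite metricC metricJ_self.
  by rewrite vz zv vJv; ring.
- move: (pair_position s c z v) h0; rewrite !enorm_sqr.
  move: (pair0 s c z v) (pair1 s c z v) => p0 p1 zE p01.
  by move: zz; rewrite zE !metric_bilin [metric p1 p0]metricC p01 => <-; ring.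
rewrite /pair0 /pair1 !metric_bilin metricJJ zz vv zJv Jvz.
by field.
Qed.

(** Write [n0] and [n1] for the squared norms and [a], [b] for the frequencies.
The hypothesis gives [a n0 + b n1 = cos psi], the contact angle; as [a] and [b]
are the roots of [x^2 = s x - s cos psi + 1], it also gives the unit speed
[a^2 n0 + b^2 n1 = 1], and the equation [gamma'' + gamma = s (i gamma' + cos psi gamma)]. *)
Lemma torus_curve_magnetic s psi w0 w1 : 0 <= psi <= pi ->
  admissible w0 w1 ->
  norm2 (Cs s psi) * (metric w1 w1 - metric w0 w0) = cos psi - s / 2 ->
  let gamma := torus_curve (s / 2 - norm2 (Cs s psi)) (s / 2 + norm2 (Cs s psi)) w0 w1 in
  magnetic_geodesic_of_strength s gamma /\
  forall t, contact_angle (gamma t) (derive1 gamma t) = psi.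
Proof.
move=> psiB adm; have c2 := norm2_Cs_sqr s psi.
set c := norm2 _ in c2 *; set a := s / 2 - c; set b := s / 2 + c => e gamma.
have [h01 ] := adm; rewrite !enorm_sqr => w01.
have [h10 _] := admissible_sym adm.
have hJ (x y : cvec R n) p q : herm x y = 0 -> herm (p *: J x) (q *: J y) = 0.
  move=> /herm_eq0P[x1 x2]; apply/herm_eq0P.
  by rewrite !JZ !metric_bilin !metricJJ x1 x2 !mulr0.
have hl (x y : cvec R n) p : herm x y = 0 -> herm x (p *: J y) = 0.
  move=> /herm_eq0P[x1 x2]; apply/herm_eq0P.
  by rewrite !metric_bilin metricJJ x1 -[metric x (J y)]opprK -metricJ x2 oppr0 !mulr0.
have d1 : derive1 gamma = torus_curve a b (a *: J w0) (b *: J w1).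
  exact: derive1_torus_curve.
have d2 : derive1 (derive1 gamma) =
    torus_curve a b (a *: J (a *: J w0)) (b *: J (b *: J w1)).
  by rewrite d1 derive1_torus_curve.
have gg t : metric (gamma t) (gamma t) = 1.
  by rewrite metric_torus_curve.
have g'g' t : metric (derive1 gamma t) (derive1 gamma t) = 1.
  rewrite d1 metric_torus_curve ?hJ// !metric_bilin !metricJJ.
  by rewrite /a /b; nra.
have gg' t : metric (gamma t) (derive1 gamma t) = 0.
  rewrite d1 metric_torus_curve ?hl// !metric_bilin.
  by rewrite ![metric _ (J _)]metricC !metricJ_self; ring.
have Jgamma t : J (gamma t) = torus_curve a b (J w0) (J w1) t.
  by rewrite /torus_curve !cscaleJ -JD.
have angle t : metric (J (gamma t)) (derive1 gamma t) = cos psi.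
  have hJ' (x y : cvec R n) q : herm x y = 0 -> herm (J x) (q *: J y) = 0.
    by move=> /(hJ _ _ 1 q); rewrite scale1r.
  rewrite Jgamma d1 metric_torus_curve ?hJ'// !metric_bilin !metricJJ.
  by rewrite /a /b; nra.
have gg'' t : metric (gamma t) (derive1 (derive1 gamma) t) = -1.
  rewrite d2 metric_torus_curve ?hl// !metric_bilin !JZ !JK !metric_bilin.
  by rewrite /a /b; nra.
split; last first.
  by move=> t; rewrite /contact_angle angle cosK// in_itv.
split; last by move=> t; apply/enorm1P.
split; [exact: smooth_torus_curve|by move=> t; apply/enorm1P|].
exists (magnetic_force s); split; first exact: magnetic_force_lorentz.
move=> t; rewrite /cov_deriv gg'' /magnetic_force.
rewrite metricJ [metric _ (J _)]metricC angle.
have e1 : a ^+ 2 = s * a - s * cos psi + 1 by rewrite /a; nra.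
have e2 : b ^+ 2 = s * b - s * cos psi + 1 by rewrite /b; nra.
rewrite d2 d1 /gamma /torus_curve JD -!cscaleJ !JZ !JK !cscaleZr !cscalerN.
rewrite !scalerA -!expr2 e1 e2.
move: (expi _ *c: w0) (expi _ *c: w1) => A B.
by apply: cvecP => j; rewrite /= !mxE; split; ring.
Qed.

End AdmissiblePairs.

(** * The rotation number as a function of the contact angle *)

Section RotationNumber.
Context (R : realType).
Implicit Types (s psi c : R).

(** Isolates the single occurrence of the norm, which makes monotonicity visible. *)
Lemma rhoE s psi : 0 < s -> rho s psi = s / (s / 2 + norm2 (Cs s psi)) - 1.
Proof.
move=> s0; have c0 : 0 <= norm2 (Cs s psi) by exact: sqrtr_ge0.
have n0 : s / 2 + norm2 (Cs s psi) != 0 by rewrite gt_eqF//; lra.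
by rewrite /rho; move: n0; set c := norm2 _ => n0; field; lra.
Qed.

Lemma rho_decreasing s : 0 < s -> {in `]0, pi[ &, {homo rho s : x y /~ x < y}}.
Proof.
move=> s0 y x yI xI /= xy.
have cos_xy : cos y < cos x.
  have sub (u : R) : u \in `]0, pi[ -> u \in `[0, pi].
    by rewrite !in_itv/= => /andP[? ?]; rewrite !ltW.
  by rewrite ltr_cos ?sub.
have cx : 0 <= norm2 (Cs s x) by exact: sqrtr_ge0.
have cy : 0 <= norm2 (Cs s y) by exact: sqrtr_ge0.
have cxy : norm2 (Cs s x) < norm2 (Cs s y).
  rewrite -(ltr_pXn2r (n := 2)) ?nnegrE// !norm2_Cs_sqr; nra.
rewrite !rhoE// ltrD2r ltr_pM2l// ltf_pV2 ?posrE; lra.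
Qed.

(** The interval is the image under a decreasing function of the range
[|1 - s / 2| < c < 1 + s / 2]; the two cases of [rho_plus] are the two signs of
[1 - s / 2]. *)
Lemma rho_inI s psi : 0 < s -> 0 < psi < pi -> rho_minus s < rho s psi < rho_plus s.
Proof.
move=> s0 psiB.
have sin0 : 0 < sin psi by exact: sin_gt0_pi.
have k1 := cos2Dsin2 psi; have k2 : -1 < cos psi < 1 by nra.
have c0 : 0 <= norm2 (Cs s psi) by exact: sqrtr_ge0.
have := norm2_Cs_sqr s psi; rewrite rhoE// /rho_minus /rho_plus.
move: c0; set c := norm2 _ => c0 c2.
have n0 : 0 < s / 2 + c by lra.
have cu : c < 1 + s / 2 by nra.
apply/andP; split.
  have -> : - (1 + s)^-1 = s / (1 + s) - 1 by field; lra.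
  rewrite ltrD2r ltr_pM2l// ltf_pV2 ?posrE; lra.
case: ifP => [s2|/negbT]; last rewrite -ltNge => s2.
  have cl : 1 - s / 2 < c by nra.
  by rewrite ltrD2r ltr_pdivrMr//; nra.
have cl : s / 2 - 1 < c by nra.
have -> : (s - 1)^-1 = s / (s - 1) - 1 by field; lra.
rewrite ltrD2r ltr_pM2l// ltf_pV2 ?posrE; lra.
Qed.

Lemma rho_surj s y : 0 < s -> rho_minus s < y < rho_plus s ->
  exists2 psi, 0 < psi < pi & rho s psi = y.
Proof.
move=> s0 /andP[yl yu].
have y1 : s / (1 + s) < 1 + y.
  have -> : s / (1 + s) = 1 + rho_minus s by rewrite /rho_minus; field; lra.
  by rewrite ltrD2l.
have y0 : 0 < 1 + y by apply: le_lt_trans y1; rewrite divr_ge0//; lra.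
(* The norm for which s / (s / 2 + c) - 1 = y; then psi is read off from c ^ 2. *)
pose d := s / (1 + y); pose c := d - s / 2.
have dE : d * (1 + y) = s by rewrite /d divfK ?gt_eqF.
have d0 : 0 < d by rewrite divr_gt0.
have cu : c < 1 + s / 2.
  suff : d < 1 + s by rewrite /c; lra.
  by rewrite /d ltr_pdivrMr//; move: y1; rewrite ltr_pdivrMr; lra.
have [cl0 cl1] : 1 - s / 2 < c /\ s / 2 - 1 < c.
  suff : 1 < d /\ s - 1 < d by rewrite /c; lra.
  move: yu; rewrite /rho_plus; case: ifP => [s2 yu|/negbT]; last rewrite -ltNge => s2 yu.
    suff : 1 < d by lra.
    by rewrite /d ltr_pdivlMr//; lra.
  suff : s - 1 < d by lra.
  rewrite /d ltr_pdivlMr//.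
  have : (s - 1) * y < 1 by rewrite mulrC -ltr_pdivlMr; [rewrite div1r|lra].
  lra.
pose k := (1 + s ^+ 2 / 4 - c ^+ 2) / s.
have kE : k * s = 1 + s ^+ 2 / 4 - c ^+ 2 by rewrite /k divfK ?gt_eqF.
have c0 : 0 < c by lra.
have kl : -1 < k by rewrite /k ltr_pdivlMr//; nra.
have ku : k < 1 by rewrite /k ltr_pdivrMr//; nra.
exists (acos k); first by rewrite acos_gt0 ?acos_ltpi//; apply/andP; lra.
have cosk : cos (acos k) = k by rewrite acosK// in_itv/=; apply/andP; lra.
have cE : norm2 (Cs s (acos k)) = c.
  have -> : norm2 (Cs s (acos k)) = Num.sqrt (c ^+ 2).
    by rewrite norm2_CsE cosk; congr Num.sqrt; lra.
  by rewrite sqrtr_sqr gtr0_norm.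
have -> : rho s (acos k) = s / d - 1.
  by rewrite rhoE// cE; congr (_ / _ - 1); rewrite /c; ring.
have -> : s / d = 1 + y.
  by apply: (mulfI (lt0r_neq0 d0)); rewrite dE mulrC divfK ?gt_eqF.
by ring.
Qed.

Lemma rho_bij s : 0 < s -> set_bij `]0, pi[ `]rho_minus s, rho_plus s[ (rho s).
Proof.
move=> s0; split.
- move=> x /=; rewrite !in_itv/=; exact: rho_inI.
- move=> x y; rewrite !inE => xI yI e.
  have [xy|yx|//] := ltgtP x y.
    by have := rho_decreasing s0 yI xI xy; rewrite e ltxx.
  by have := rho_decreasing s0 xI yI yx; rewrite e ltxx.
- move=> y /=; rewrite in_itv/= => /(rho_surj s0)[psi psiB <-].
  by exists psi => //=; rewrite in_itv.
Qed.

End RotationNumber.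

(** * Smooth dependence of the pair on the initial data *)

Section SmoothDependence.
Context (R : realType) (n : nat).
Notation E := (R^o * cvec R n * cvec R n)%type.

Definition geodesic_pair (p : E) : cvec R n * cvec R n :=
  let c := norm2 (Cs p.1.1 (contact_angle p.1.2 p.2)) in
  (pair0 p.1.1 c p.1.2 p.2, pair1 p.1.1 c p.1.2 p.2).

Let proj_s (p : E) : R^o := p.1.1.
Let proj_z (p : E) : cvec R n := p.1.2.
Let proj_v (p : E) : cvec R n := p.2.

Lemma proj_continuous :
  [/\ continuous proj_s, continuous proj_z & continuous proj_v].
Proof.
split=> p.
- by apply: (@continuous_comp _ _ _ fst fst); exact: cvg_fst.
- by apply: (@continuous_comp _ _ _ fst snd); [exact: cvg_fst|exact: cvg_snd].
- exact: cvg_snd.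
Qed.

(** On unit tangent vectors this is [c ^ 2]; being polynomial in [(s, z, v)], it is
smooth on the whole ambient space, unlike [acos]. *)
Definition squared_norm_Cs (p : E) : R^o :=
  (1 + - proj_s p * metric (J (proj_z p)) (proj_v p)) + 4^-1 * (proj_s p * proj_s p).

Lemma squared_norm_CsE p : unit_tangent p.1.2 p.2 ->
  squared_norm_Cs p = norm2 (Cs p.1.1 (contact_angle p.1.2 p.2)) ^+ 2.
Proof.
move=> /contact_angleP[e _]; rewrite norm2_Cs_sqr e /squared_norm_Cs /proj_s /proj_z /proj_v.
by field.
Qed.

Lemma Ck_squared_norm_Cs k (U : set E) : open U -> Ck k U squared_norm_Cs.
Proof.
move=> oU; have [sc zc vc] := proj_continuous.
have sl : linear proj_s by [].
have zl : linear proj_z by [].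
have vl : linear proj_v by [].
have HM := @continuous_bilinear_mul R.
have HS := @continuous_bilinear_scale R.
have Jz : Ck k U (fun p => J (proj_z p)).
  apply: Ck_linear => //; first by move=> a x y; rewrite zl J_linear.
  by move=> p; apply: continuous_comp; [exact: zc|exact: J_continuous].
have sk := Ck_linear k oU sl sc.
have Ns : Ck k U (fun p => - proj_s p : R^o).
  apply: Ck_linear => //; first by move=> a x y; rewrite sl opprD scalerN.
  by move=> p; apply: cvgN; exact: sc.
apply: CkD => //; first apply: CkD => //.
- exact: Ck_cst.
- apply: (Ck_bilinear HM) => //.
  apply: (Ck_bilinear (@metric_continuous_bilinear R n)) => //.
  exact: Ck_linear.
- apply: (Ck_bilinear HM) => //; first exact: Ck_cst.
  exact: (Ck_bilinear HM).
Qed.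

(** The extension is a sum of linear maps with coefficients [1], [s / c] and
[1 / c], defined where the polynomial [c ^ 2] is positive. *)
Lemma smooth_geodesic_pair : smooth_on (@parameter_domain R n) geodesic_pair.
Proof.
have [sc zc vc] := proj_continuous.
have sl : linear proj_s by [].
have zl : linear proj_z by [].
have vl : linear proj_v by [].
pose L (M : cvec R n -> cvec R n) (a b : R) (x : cvec R n) : cvec R n * cvec R n :=
  (a *: M x, b *: M x).
have LP (M : cvec R n -> cvec R n) a b :
    linear M -> continuous M -> linear (L M a b) /\ continuous (L M a b).
  move=> Ml Mc; split=> [c x y|x].
    by rewrite /L Ml !scalerDr !scalerA ![_ * c]mulrC -!scalerA.
  apply: (@cvg_pair _ _ _ (nbhs x) (nbhs (a *: M x)) (nbhs (b *: M x)));
    by apply: cvgZ; [exact: cvg_cst|exact: Mc].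
have CkL k (U : set E) (M : cvec R n -> cvec R n) a b (P : E -> cvec R n) :
    open U -> linear M -> continuous M ->
    linear P -> continuous P -> Ck k U (fun p => L M a b (P p)).
  move=> oU Ml Mc Pl Pc; have [Ll Lc] := LP M a b Ml Mc.
  apply: Ck_linear => //; first by move=> c x y; rewrite Pl Ll.
  by move=> p; apply: continuous_comp; [exact: Pc|exact: Lc].
pose r p : R^o := (Num.sqrt (squared_norm_Cs p))^-1.
pose F p := L id 2^-1 2^-1 (proj_z p) +
  ((proj_s p * r p) *: L id 4^-1 (- 4^-1) (proj_z p) +
   r p *: L J 2^-1 (- 2^-1) (proj_v p)).
pose U := squared_norm_Cs @^-1` [set x | 0 < x].
have oU : open U.
  apply: open_comp; last exact: open_gt.
  move=> p _; apply: (Ck_continuous (@Ck_squared_norm_Cs 0 setT openT)) => //.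
have FW p : unit_tangent p.1.2 p.2 -> U p -> F p = geodesic_pair p.
  move=> pT Up; rewrite /F /geodesic_pair /r squared_norm_CsE//.
  rewrite sqrtr_sqr ger0_norm ?sqrtr_ge0//.
  have : norm2 (Cs p.1.1 (contact_angle p.1.2 p.2)) != 0.
    move: Up; rewrite /U /= squared_norm_CsE// => h; apply/eqP => c0.
    by move: h; rewrite c0 expr0n ltxx.
  set c := norm2 _ => c0; rewrite /L /proj_s /proj_z /proj_v /pair0 /pair1 /=.
  by congr pair; apply: cvecP => j; rewrite /= !mxE; split; field.
move=> p [/= s0 pT pole]; exists U, F; split=> //.
- rewrite /U /= squared_norm_CsE// exprn_gt0//; apply: norm2_Cs_gt0; first exact: ltW.
    by have [] := contact_angleP pT.
  exact: pole.
- have id_linear : linear (id : cvec R n -> cvec R n) by [].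
  have id_cont : continuous (id : cvec R n -> cvec R n) by move=> x; exact: cvg_id.
  move=> k; apply: CkD => //; first exact: CkL id_linear id_cont zl zc.
  have rk : Ck k U r by apply: Ck_invsqrt => //; exact: Ck_squared_norm_Cs.
  have HS := @continuous_bilinear_scale R.
  apply: CkD => //; apply: (Ck_bilinear (HS _)) => //.
  + apply: (Ck_bilinear (@continuous_bilinear_mul R)) => //.
    exact: Ck_linear.
  + exact: CkL id_linear id_cont zl zc.
  + exact: CkL (@J_linear R n) (@J_continuous R n) vl vc.
- by move=> x [_ xT _] Ux; exact: FW.
Qed.

End SmoothDependence.

(** * The parametrization by Clifford tori *)

Theorem theorem1p9 (R : realType) (n : nat) :
  (exists W : R^o * cvec R n * cvec R n -> cvec R n * cvec R n,
    smooth_on (@parameter_domain R n) W /\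
    forall (s : R) (z v : cvec R n),
      0 <= s -> unit_tangent z v -> ~ (s = 2 /\ contact_angle z v = 0) ->
      let psi := contact_angle z v in
      let c := norm2 (Cs s psi) in
      let w0 := (W (s, z, v)).1 in
      let w1 := (W (s, z, v)).2 in
      [/\ w0 = (2 * iC R * c%:C)^-1 *c: ((iC R * (c + s / 2)%:C) *c: z - v),
          w1 = (2 * iC R * c%:C)^-1 *c: ((iC R * (c - s / 2)%:C) *c: z + v),
          z = w0 + w1,
          v = (iC R * (s / 2)%:C) *c: (w0 + w1) + (iC R * c%:C) *c: (w1 - w0) &
          [/\ admissible w0 w1,
              pair_width w1 w0 (Arg (Cs s psi)),
              torus_width (clifford_torus w0 w1) (Arg (Cs s psi)) &
              forall gamma : R -> cvec R n,
                magnetic_geodesic_of_strength s gamma ->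
                gamma 0 = z -> derive1 gamma 0 = v ->
                [/\ forall t, clifford_torus w0 w1 (gamma t),
                    geodesic_form s psi w0 w1 gamma &
                    0 < psi < pi ->
                    has_rotation_number w0 w1 gamma (rho s psi)]]]) /\
  (forall s : R, 0 < s ->
    set_bij `]0, pi[ `]rho_minus s, rho_plus s[ (rho s) /\
    {in `]0, pi[ &, {homo rho s : x y /~ x < y}}) /\
  (forall (s psi : R) (w0 w1 : cvec R n) (gamma : R -> cvec R n),
    0 <= s -> 0 <= psi <= pi ->
    admissible w0 w1 -> pair_width w1 w0 (Arg (Cs s psi)) ->
    geodesic_form s psi w0 w1 gamma ->
    magnetic_geodesic_of_strength s gamma /\
    forall t, contact_angle (gamma t) (derive1 gamma t) = psi).
Proof.
split; last split.
- exists (@geodesic_pair R n); split; first exact: smooth_geodesic_pair.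
  move=> s z v s0 zv pole psi c w0 w1.
  have [cos_psi psiB] := contact_angleP zv.
  have c0 : 0 < c by exact: norm2_Cs_gt0.
  have cn0 : c != 0 by rewrite gt_eqF.
  have c2 := norm2_Cs_sqr s psi; rewrite -/c in c2.
  have c2' := c2; rewrite cos_psi in c2'.
  have [adm diff] := pair_admissible zv cn0 c2'.
  have zE : z = w0 + w1 := pair_position s c z v.
  have vE : v = (s / 2 - c) *: J w0 + (s / 2 + c) *: J w1 := pair_velocity s z v cn0.
  rewrite -/w0 -/w1 in adm.
  have {}diff : c * (metric w1 w1 - metric w0 w0) = cos psi - s / 2 by rewrite cos_psi.
  have width : pair_width w1 w0 (Arg (Cs s psi)).
    apply/pair_widthP => //; first exact: Arg_ge0_lepi.
    apply: (mulfI cn0); rewrite diff norm2_cos_Arg /=; ring.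
  split; [by rewrite pair0E|by rewrite pair1E|exact: zE| |split=> //].
  + rewrite !iC_real_cscale {1}vE !JD JN.
    by apply: cvecP => j; rewrite /= !mxE; split; ring.
  + exists w1, w0; split=> //; [exact: admissible_sym|exact: clifford_torus_sym].
  move=> gamma geo g0 v0.
  have [d1 d2 ode] := magnetic_geodesic_ode geo g0 v0.
  have gE t : gamma t = torus_curve (s / 2 - c) (s / 2 + c) w0 w1 t.
    apply: (second_order_ode _ d1 d2) => //.
    * by apply/eqP; lra.
    * move=> x; rewrite ode -cos_psi; congr (_ *: _ + _ *: _); first by lra.
      rewrite -/psi; nra.
    * by rewrite g0.
    * by rewrite v0.
  split.
  + by move=> t; rewrite gE; exact: torus_curve_in.
  + by apply/geodesic_formE/funext.
  move=> /sin_gt0_pi sin_psi.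
  have [_ w01] := adm; rewrite !enorm_sqr in w01.
  have trig := cos2Dsin2 psi.
  have metric0 : metric (0 : cvec R n) 0 = 0 by rewrite -(scale0r 0) metricZl mul0r.
  split; last exists (s / 2 - c), (s / 2 + c); last split=> //.
  + apply/eqP => w00; have n0 : metric w0 w0 = 0 by rewrite w00.
    have n1 : metric w1 w1 = 1 by lra.
    by move: diff; rewrite n0 n1 => diff; nra.
  + apply/eqP => w10; have n1 : metric w1 w1 = 0 by rewrite w10.
    have n0 : metric w0 w0 = 1 by lra.
    by move: diff; rewrite n0 n1 => diff; nra.
  + by apply/eqP; lra.
- by move=> s s0; split; [exact: rho_bij|exact: rho_decreasing].
- move=> s psi w0 w1 gamma s0 psiB adm width /geodesic_formE ->.
  apply: torus_curve_magnetic => //.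
  move/(pair_widthP adm (Arg_ge0_lepi _)): width => ->.
  by rewrite norm2_cos_Arg /=; ring.
Qed.
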